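(* Fix $d\ge2$ and $t\in\mathbb N$, $t\ge1$. For each $c\in\mathbb S^{d-1}$ let $\preccurlyeq_c$ denote the preference relation on $\mathcal X$ realized by $f_c(x)=\langle c,x\rangle$. For any algorithm with $t$ comparisons, and for every realization of its private random seed $\xi$, there exist $c,\hat c\in\mathbb S^{d-1}$ such that $$\angle(c,\hat c)>2^{-(t+1)/(d-1)},$$ and, under the same $\xi$, the algorithm receives the same comparison transcript under $\preccurlyeq_c$ and under $\preccurlyeq_{\hat c}$.
   Context: $\mathcal X$ is a $d$-dimensional real Euclidean space with inner product $\langle\cdot,\cdot\rangle$ and unit sphere $\mathbb S^{d-1}$; $\angle(u,v)=\arccos\frac{\langle u,v\rangle}{\|u\|\|v\|}\in[0,\pi]$. A function $f$ realizes $\preccurlyeq$ if $x\preccurlyeq y\iff f(x)\le f(y)$. The comparison oracle of $\preccurlyeq_c$ on the pair $(p,q)$ returns $\operatorname{sign}(f_c(q)-f_c(p))\in\{-1,0,+1\}$. An algorithm with $t$ comparisons has a private random seed $\xi$ sampled before the run. At round $i=1,\dots,t$, having observed the history $\mathcal T_{i-1}=((p_1,q_1,\sigma_1),\dots,(p_{i-1},q_{i-1},\sigma_{i-1}))$, where $\sigma_j$ is the oracle response to $(p_j,q_j)$, it chooses the next pair $(p_i,q_i)\in\mathcal X\times\mathcal X$ as a measurable function of $(\mathcal T_{i-1},\xi)$. After $t$ rounds its output is a measurable function of $(\mathcal T_t,\xi)$. The comparison transcript is $\mathcal T_t$. *)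

(* Defs.v *)
From HB Require Import structures.
From mathcomp Require Import all_boot all_order all_algebra.
From mathcomp Require Import all_classical all_reals all_analysis.

Set Implicit Arguments.
Unset Strict Implicit.
Unset Printing Implicit Defensive.
Import Order.TTheory GRing.Theory Num.Theory.
Local Open Scope classical_set_scope.
Local Open Scope ring_scope.

Section Euclidean.
Context {R : realType} {X : vectType R} (dot : {dot X for idfun}).

Definition dnorm (u : X) : R := Num.sqrt (dot u u).

Definition usphere : set X := [set c | dnorm c = 1].

Definition angle (u v : X) : R := acos (dot u v / (dnorm u * dnorm v)).

Definition dball (x : X) (r : R) : set X := [set y | dnorm (y - x) < r].

Definition dopen : set (set X) :=
  [set U | forall x, U x -> exists2 r, 0 < r & dball x r `<=` U].

End Euclidean.

(* The space X with the Borel sigma-algebra of the distance given by the inner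
   product; a [vectType] has no topology or sigma-algebra of its own. *)
Definition euclid (R : realType) (X : vectType R) (dot : {dot X for idfun})
  : Type := X.

HB.instance Definition _ (R : realType) (X : vectType R)
  (dot : {dot X for idfun}) := GRing.Zmodule.on (euclid dot).
HB.instance Definition _ (R : realType) (X : vectType R)
  (dot : {dot X for idfun}) := isPointed.Build (euclid dot) 0.

Section Borel.
Context {R : realType} {X : vectType R} (dot : {dot X for idfun}).

Let E : pointedType := euclid dot.
Let borel : set (set E) := <<s (dopen dot : set (set E)) >>.

Let borel0 : borel set0.
Proof. exact: sigma_algebra0. Qed.

Let borelC (A : set E) : borel A -> borel (~` A).
Proof. exact: sigma_algebraC. Qed.

Let borelU (F : (set E)^nat) :
  (forall i, borel (F i)) -> borel (\bigcup_i F i).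
Proof. exact: sigma_algebra_bigcup. Qed.

HB.instance Definition _ := @isMeasurable.Build default_measure_display
  (euclid dot) borel borel0 borelC borelU.

End Borel.

Definition signs : seq int := [:: -1; 0; 1].

(* The three-point type {-1, 0, +1}, with the discrete sigma-algebra. *)
Definition response : Type := seq_sub signs.

HB.instance Definition _ := Finite.on response.

Lemma sgz_signs (R : realDomainType) (x : R) : sgz x \in signs.
Proof. by case: sgzP. Qed.

Definition sign (R : realDomainType) (x : R) : response :=
  SeqSub (sgz_signs x).

HB.instance Definition _ := isPointed.Build response (sign (0 : int)).
HB.instance Definition _ := @isMeasurable.Build default_measure_display
  response discrete_measurable (@discrete_measurable0 _)
  (@discrete_measurableC _) (@discrete_measurableU _).

Definition realizes (R : realType) (X : Type) (f : X -> R) (pref : rel X) :=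
  forall x y, pref x y <-> f x <= f y.

Section Oracle.
Context {R : realType} {X : vectType R} (dot : {dot X for idfun}).

Definition utility (c x : X) : R := dot c x.

Definition pref (c : X) : rel X := fun x y => utility c x <= utility c y.

Lemma utility_realizes (c : X) : realizes (utility c) (pref c).
Proof. by []. Qed.

Definition oracle (c p q : X) : response := sign (utility c q - utility c p).

(* The response depends on c only through the preference relation. *)
Lemma oracle_pref (c p q : X) :
  ssval (oracle c p q)
    = if ~~ pref c p q then -1 else if pref c q p then 0 else 1.
Proof.
rewrite /oracle /sign /= /pref.
case: (ltgtP (utility c p) (utility c q)) => [h|h|->] /=.
- by rewrite gtr0_sgz // subr_gt0.
- by rewrite ltr0_sgz // subr_lt0.
- by rewrite subrr sgz0.
Qed.

End Oracle.

(* One entry (p, q, sigma) of the comparison history. *)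
Notation round dot := (euclid dot * euclid dot * response)%type.

(* An algorithm with t comparisons, seed space Omega and output space Y.
   Rounds are counted from 0, so [query i] reads a history of length i. *)
Record algorithm (R : realType) (X : vectType R) (dot : {dot X for idfun})
    (dO : measure_display) (Omega : measurableType dO)
    (dY : measure_display) (Y : measurableType dY) (t : nat) := Algorithm {
  seed_law : probability Omega R;
  query : forall i : 'I_t,
    i.-tuple (round dot) * Omega -> euclid dot * euclid dot;
  output : t.-tuple (round dot) * Omega -> Y;
  measurable_query : forall i : 'I_t, measurable_fun setT (@query i);
  measurable_output : measurable_fun setT output }.

Section Transcript.
Context {R : realType} {X : vectType R} {dot : {dot X for idfun}}.
Context {dO : measure_display} {Omega : measurableType dO}.
Context {dY : measure_display} {Y : measurableType dY} {t : nat}.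
Variables (alg : algorithm dot Omega Y t) (xi : Omega) (c : X).

Fixpoint history (k : nat) : (k <= t)%N -> k.-tuple (round dot) :=
  match k with
  | 0 => fun _ => [tuple]
  | k'.+1 => fun lt_k't =>
      let h := history (ltnW lt_k't) in
      let pq := query alg (i := Ordinal lt_k't) (h, xi) in
      rcons_tuple h (pq.1, pq.2, oracle dot c pq.1 pq.2)
  end.

Definition transcript : t.-tuple (round dot) := history (leqnn t).

End Transcript.

(* Main.v *)
Require Import Defs.
From HB Require Import structures.
From mathcomp Require Import all_boot all_order all_algebra.
From mathcomp Require Import all_classical all_reals all_analysis.
From mathcomp Require Import ring lra zify.
Import Order.TTheory GRing.Theory Num.Theory.
Local Open Scope classical_set_scope.
Local Open Scope ring_scope.

(** Let m = d - 1 and delta^m = 2^-(t+1).  There are 2^t + 1 unit vectors at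
    pairwise distance > delta: otherwise the unit ball of an m-dimensional
    subspace is covered by 2^t balls of radius delta, hence, rescaling the cover
    k times, by 2^(t k) balls of radius delta^k; for k = m j this contradicts the
    roughly (2^((t+1) j))^m separated points of a grid.  Points of the flat ball
    are lifted to the upper hemisphere, which only increases distances.

    Facing an algorithm, an adversary starts from these 2^t + 1 vectors and keeps
    at every round those lying on the more populated side of the query
    hyperplane, after an arbitrarily small perturbation of the vectors on the
    hyperplane.  Two vectors survive t rounds with a common transcript, and their
    angle is at least their distance. *)

(** * Norm of a real inner product and the Cauchy-Schwarz inequality *)

Section InnerProduct.
Context {R : realType} {X : vectType R} (dot : {dot X for idfun}).
Implicit Types (u v w : X) (a b : R).

Lemma dotC u v : dot u v = dot v u.
Proof. by rewrite hermC /= mul1r. Qed.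

Lemma dotZl a u v : dot (a *: u) v = a * dot u v.
Proof. by rewrite linearZl_LR. Qed.

Lemma dotZr a u v : dot u (a *: v) = a * dot u v.
Proof. by rewrite dotC dotZl dotC. Qed.

Lemma dot_ge0 u : 0 <= dot u u.
Proof.
have [->|u0] := eqVneq u 0; first by rewrite linear0r.
exact/ltW/neq0_dnorm_gt0.
Qed.

Lemma dot_sqrD u v : dot (u + v) (u + v) = dot u u + 2 * dot u v + dot v v.
Proof. rewrite linearDl !linearDr /= (dotC v u); ring. Qed.

Lemma dot_sqrB u v : dot (u - v) (u - v) = dot u u - 2 * dot u v + dot v v.
Proof. rewrite linearBl !linearBr /= (dotC v u); ring. Qed.

Lemma dnormr_ge0 u : 0 <= dnorm dot u.
Proof. exact: sqrtr_ge0. Qed.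

Lemma sqr_dnorm u : dnorm dot u ^+ 2 = dot u u.
Proof. by rewrite sqr_sqrtr ?dot_ge0. Qed.

Lemma dnormr0 : dnorm dot 0 = 0.
Proof. by rewrite /dnorm linear0r sqrtr0. Qed.

Lemma dnormr_eq0 u : (dnorm dot u == 0) = (u == 0).
Proof.
have [->|u0] := eqVneq u 0; first by rewrite dnormr0 !eqxx.
by rewrite gt_eqF // sqrtr_gt0 neq0_dnorm_gt0.
Qed.

Lemma dnormrZ a u : dnorm dot (a *: u) = `|a| * dnorm dot u.
Proof.
by rewrite /dnorm dotZl dotZr mulrA -expr2 sqrtrM ?sqr_ge0 // sqrtr_sqr.
Qed.

Lemma dnormrN u : dnorm dot (- u) = dnorm dot u.
Proof. by rewrite -scaleN1r dnormrZ normrN1 mul1r. Qed.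

Lemma dnormr_distC u v : dnorm dot (u - v) = dnorm dot (v - u).
Proof. by rewrite -dnormrN opprB. Qed.

(** With a, b the norms of u, v, the squared norms of b u + a v and b u - a v are nonnegative and
    factor as 2ab times ab + <u,v> and ab - <u,v>. *)
Lemma dot_le_dnorm u v : `|dot u v| <= dnorm dot u * dnorm dot v.
Proof.
have [->|u0] := eqVneq u 0.
  by rewrite linear0l normr0 mulr_ge0 ?dnormr_ge0.
have [->|v0] := eqVneq v 0.
  by rewrite linear0r normr0 mulr_ge0 ?dnormr_ge0.
have pos w : w != 0 -> 0 < dnorm dot w.
  by move=> w0; rewrite lt_def dnormr_ge0 dnormr_eq0 w0.
have up := pos _ u0; have vp := pos _ v0.
have := dot_ge0 (dnorm dot v *: u - dnorm dot u *: v).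
have := dot_ge0 (dnorm dot v *: u + dnorm dot u *: v).
rewrite dot_sqrD dot_sqrB !(dotZl, dotZr) -!sqr_dnorm.
move: (dot u v) (dnorm dot u) (dnorm dot v) up vp => d a b a0 b0.
have -> : b * (b * a ^+ 2) + 2 * (b * (a * d)) + a * (a * b ^+ 2) =
  (2 * a * b) * (a * b + d) by ring.
have -> : b * (b * a ^+ 2) - 2 * (b * (a * d)) + a * (a * b ^+ 2) =
  (2 * a * b) * (a * b - d) by ring.
have ab0 : 0 < 2 * a * b by rewrite !mulr_gt0.
by rewrite !pmulr_rge0 // => h1 h2; rewrite ler_norml; apply/andP; split; lra.
Qed.

Lemma dnormrD u v : dnorm dot (u + v) <= dnorm dot u + dnorm dot v.
Proof.
rewrite -ler_sqr ?nnegrE ?addr_ge0 ?dnormr_ge0 // sqr_dnorm dot_sqrD.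
have := le_trans (ler_norm _) (dot_le_dnorm u v); rewrite -!sqr_dnorm sqrrD.
lra.
Qed.

Lemma dnorm_dist_trans w u v :
  dnorm dot (u - v) <= dnorm dot (u - w) + dnorm dot (w - v).
Proof. by rewrite (le_trans _ (dnormrD _ _)) // addrA subrK. Qed.

Lemma dot_unit c : usphere dot c -> dot c c = 1.
Proof. by rewrite -sqr_dnorm => ->; rewrite expr1n. Qed.

End InnerProduct.

(** * Chord length against angle on the unit sphere *)

Section Angle.
Import numFieldNormedType.Exports.
Context {R : realType}.

Lemma sin_le_id (x : R) : 0 <= x -> sin x <= x.
Proof.
move=> x0.
have sin_cont : {within `[0, x], continuous (sin : R -> R)}.
  by apply: continuous_subspaceT => y; exact: continuous_sin.
have [c _] := MVT_segment x0 (fun y _ => is_derive_sin y) sin_cont.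
rewrite sin0 !subr0 => ->; rewrite ler_piMl //; exact: cos_le1.
Qed.

(** Half-angle formula: 1 - cos x = 2 sin(x/2)^2, and |sin(x/2)| <= x/2. *)
Lemma one_subr_cos_le (x : R) : 0 <= x -> 1 - cos x <= x ^+ 2 / 2.
Proof.
move=> x0; rewrite -[x in cos x](divfK (lt0r_neq0 (ltr0Sn R 1))).
rewrite mulr_natr cos_mulr2n cos2sin2.
have h0 : 0 <= x / 2 by lra.
have h1 := sin_le_id _ h0.
have h2 : `|sin (x / 2)| <= x / 2.
  have [hpi|hpi] := leP (x / 2) pi.
    by rewrite ger0_norm // sin_ge0_pi // h0 hpi.
  (* Beyond pi the bound |sin| <= 1 suffices. *)
  rewrite (le_trans _ (ltW hpi)) //.
  have := pihalf_ge1 R; rewrite ler_norml; have := sin_le1 (x / 2).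
  have := sin_geN1 (x / 2); lra.
have : sin (x / 2) ^+ 2 <= (x / 2) ^+ 2 by rewrite -real_normK ?num_real // lerXn2r // nnegrE.
lra.
Qed.

Context {X : vectType R} (dot : {dot X for idfun}).

(** The squared chord is 2 - 2 cos of the angle, at most the squared angle. *)
Lemma dnorm_dist_le_angle (u v : X) : usphere dot u -> usphere dot v ->
  dnorm dot (u - v) <= angle dot u v.
Proof.
move=> u1 v1; rewrite /angle u1 v1 mulr1 divr1.
have := dot_le_dnorm dot u v; rewrite u1 v1 mulr1 ler_norml => duv.
have a0 := acos_ge0 duv.
rewrite -ler_sqr ?nnegrE ?dnormr_ge0 // sqr_dnorm dot_sqrB !dot_unit //.
have := one_subr_cos_le _ a0; rewrite acosK //; lra.
Qed.

End Angle.

(** * Separated sets in the flat ball and on the sphere *)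

Section Packing.
Context {R : realType} {X : vectType R} (dot : {dot X for idfun}).

(** Gram-Schmidt by complements: [V] is orthogonal to the vectors chosen so far and loses at most
    one dimension per step, so a unit vector can be picked in it. *)
Lemma orthonormal_family (k : nat) : (k <= \dim {:X})%N ->
  exists e : nat -> X, forall i j, (i < k)%N -> (j < k)%N ->
    dot (e i) (e j) = (i == j)%:R.
Proof.
move=> kd; suff [e [V [eV _ eE]]] : exists (e : nat -> X) (V : {vspace X}),
    [/\ forall i v, (i < k)%N -> v \in V -> dot v (e i) = 0,
        (\dim {:X} <= \dim V + k)%N
      & forall i j, (i < k)%N -> (j < k)%N -> dot (e i) (e j) = (i == j)%:R].
  by exists e.
elim: k kd => [|k IH] kd; first by exists (fun=> 0), fullv; rewrite addn0; split.
have [e [V [eV dV eE]]] := IH (ltnW kd).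
have V0 : V != 0%VS by rewrite -dimv_eq0; lia.
pose v := (dnorm dot (vpick V))^-1 *: vpick V.
have vV : v \in V by rewrite memvZ ?memv_pick.
have v1 : dot v v = 1.
  rewrite -sqr_dnorm dnormrZ ger0_norm ?invr_ge0 ?dnormr_ge0 // mulVf ?expr1n //.
  by rewrite dnormr_eq0 vpick0.
exists (fun i => if i == k then v else e i), (V :&: orthov dot <[v]>)%VS; split.
- move=> i w ik; rewrite memv_cap mem_orthov1 => /andP[wV /eqP wv].
  by case: eqP => // ik'; apply: eV => //; lia.
- have := leq_dim_orthov1 dot v V.
  have : (0 < \dim V)%N by rewrite lt0n dimv_eq0.
  lia.
- move=> i j ik jk.
  case: (eqVneq i k) => [->|ik']; case: (eqVneq j k) => [jk'|jk'] //=.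
  + by rewrite (eV j) //; lia.
  + by rewrite dotC (eV i) ?jk' ?(negbTE ik') //; lia.
  + by rewrite eE //; lia.
Qed.

Definition separated (delta : R) (s : seq X) :=
  uniq s /\ {in s &, forall x y, x != y -> delta < dnorm dot (x - y)}.

(** Greedy choice: a separated set that cannot be extended is a cover. *)
Lemma pack_or_cover (B : X -> Prop) (delta : R) (k : nat) : 0 <= delta ->
  (exists s, [/\ size s = k, forall x, x \in s -> B x & separated delta s]) \/
  (exists s, [/\ (size s < k)%N, forall x, x \in s -> B x
     & forall x, B x -> exists2 p, p \in s & dnorm dot (x - p) <= delta]).
Proof.
move=> d0; elim: k => [|k [[s [sk sB [us ps]]]|[s [sk sB sc]]]].
- by left; exists [::].
- have [[x [Bx /allP xs]]|nx] := pselect (exists x, B x /\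
      all (fun p => delta < dnorm dot (x - p)) s).
    left; exists (x :: s); rewrite /= sk; split=> //.
      by move=> y; rewrite inE => /predU1P[->|/sB].
    split=> /= [|y z].
      rewrite us andbT; apply/negP => /xs.
      by rewrite subrr dnormr0 ltNge d0.
    rewrite !inE => /predU1P[->|ys] /predU1P[->|zs]; rewrite ?eqxx //.
    + by move=> _; exact: xs.
    + by move=> _; rewrite dnormr_distC; exact: xs.
    + exact: ps.
  right; exists s; rewrite sk; split=> // x Bx.
  have /allPn[p ps' px] : ~~ all (fun p => delta < dnorm dot (x - p)) s.
    by apply/negP => xs; apply: nx; exists x.
  by exists p => //; rewrite leNgt.
- by right; exists s; split=> //; exact: ltnW.
Qed.

(* Rescaling the cover turns one of size N at scale delta into one of size N^k
   at scale delta^k. *)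
Lemma ball_cover_exp (V : {vspace X}) (delta : R) (s : seq X) (k : nat) :
  0 < delta -> {subset s <= V} ->
  (forall x, x \in V -> dnorm dot x <= 1 ->
     exists2 p, p \in s & dnorm dot (x - p) <= delta) ->
  exists s' : seq X, [/\ size s' = (size s ^ k)%N, {subset s' <= V}
    & forall x, x \in V -> dnorm dot x <= 1 ->
      exists2 p, p \in s' & dnorm dot (x - p) <= delta ^+ k].
Proof.
move=> d0 sV sc; elim: k => [|k [s' [ss' s'V s'c]]].
  exists [:: 0]; split=> // [x|x xV x1]; first by rewrite inE => /eqP->; exact: mem0v.
  by exists 0; rewrite ?inE // subr0 expr0.
exists [seq p + delta ^+ k *: q | p <- s', q <- s]; split.
- by rewrite size_allpairs ss' expnSr.
- move=> _ /allpairsP[[p q] /= [ps qs ->]].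
  by apply: memvD; [exact: s'V|apply: memvZ; exact: sV].
- move=> x xV x1; have [p ps xp] := s'c _ xV x1.
  have dk : 0 < delta ^+ k by exact: exprn_gt0.
  have [||q qs xq] := sc ((delta ^+ k)^-1 *: (x - p)).
  + by apply: memvZ; apply: memvB => //; exact: s'V.
  + by rewrite dnormrZ gtr0_norm ?invr_gt0 // mulrC ler_pdivrMr // mul1r.
  + exists (p + delta ^+ k *: q); first by apply/allpairsP; exists (p, q).
    have -> : x - (p + delta ^+ k *: q) =
        delta ^+ k *: ((delta ^+ k)^-1 *: (x - p) - q).
      by rewrite scalerBr scalerA divff ?gt_eqF // scale1r opprD addrA.
    by rewrite dnormrZ gtr0_norm // exprSr ler_pM2l.
Qed.

Lemma dot_orthonormal_sum (m : nat) (e : 'I_m -> X) (a b : 'I_m -> R) :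
  (forall i j, dot (e i) (e j) = (i == j)%:R) ->
  dot (\sum_i a i *: e i) (\sum_i b i *: e i) = \sum_i a i * b i.
Proof.
move=> eE; rewrite linear_sumlz; apply: eq_bigr => i _.
rewrite linear_sumr (bigD1 i) //= big1 ?addr0 => [|j ji].
  by rewrite dotZl dotZr eE eqxx mulr1.
by rewrite dotZl dotZr eE eq_sym (negbTE ji) !mulr0.
Qed.

(** Grid points with coordinates a_i/(mn), a_i < n, lie in the unit ball and are at least 1/(mn) >
    2r apart, so no centre serves two of them. *)
Lemma grid_le_cover (V : {vspace X}) (m n : nat) (e : 'I_m -> X) (r : R)
    (s : seq X) :
  (0 < m)%N -> (0 < n)%N ->
  (forall i, e i \in V) -> (forall i j, dot (e i) (e j) = (i == j)%:R) ->
  (forall x, x \in V -> dnorm dot x <= 1 ->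
     exists2 p, p \in s & dnorm dot (x - p) <= r) ->
  2 * r * (m * n)%:R < 1 -> (n ^ m <= size s)%N.
Proof.
move=> m0 n0 eV eE sc rmn.
have M0 : 0 < (m * n)%:R :> R by rewrite ltr0n muln_gt0 m0.
pose g (a : {ffun 'I_m -> 'I_n}) : X := \sum_i ((a i)%:R / (m * n)%:R) *: e i.
have gV a : g a \in V by apply: memv_suml => i _; rewrite memvZ.
have g1 a : dnorm dot (g a) <= 1.
  rewrite -(@ler_pXn2r _ 2) ?nnegrE ?dnormr_ge0 // expr1n sqr_dnorm.
  rewrite dot_orthonormal_sum //.
  apply: (@le_trans _ _ (\sum_(i < m) m%:R^-1)); last first.
    rewrite sumr_const card_ord -[_ *+ m]mulr_natl divff //.
    by rewrite pnatr_eq0 -lt0n.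
  apply: ler_sum => i _.
  have ai : (a i)%:R / (m * n)%:R <= m%:R^-1 :> R.
    rewrite natrM invfM mulrCA ler_piMr ?invr_ge0 //.
    by rewrite ler_pdivrMr ?ltr0n // mul1r ler_nat ltnW.
  have m1 : m%:R^-1 <= 1 :> R by rewrite invf_le1 ?ler1n ?ltr0n.
  have ai0 : 0 <= (a i)%:R / (m * n)%:R :> R by rewrite divr_ge0.
  by rewrite -[leRHS]mulr1 ler_pM // (le_trans ai).
have gB a b : a != b -> (m * n)%:R^-1 <= dnorm dot (g a - g b).
  move=> ab; have [i ai] : exists i, a i != b i.
    apply/existsP; rewrite -negb_forall; apply: contra ab => /forallP ab.
    by apply/eqP/ffunP => i; exact/eqP.
  rewrite -(@ler_pXn2r _ 2) ?nnegrE ?dnormr_ge0 ?invr_ge0 ?(ltW M0) // sqr_dnorm.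
  have -> : g a - g b =
      \sum_i (((a i)%:R - (b i)%:R) / (m * n)%:R) *: e i.
    by rewrite -sumrB; apply: eq_bigr => j _; rewrite -scalerBl mulrBl.
  rewrite dot_orthonormal_sum // (bigD1 i) //= -expr2 exprMn.
  have d1 : 1 <= ((a i)%:R - (b i)%:R) ^+ 2 :> R.
    rewrite -real_normK ?num_real // expr_ge1 //.
    have [lt|lt|/val_inj eq] := ltngtP (a i) (b i); last by rewrite eq eqxx in ai.
      by rewrite distrC -(natrB _ (ltnW lt)) normr_nat ler1n subn_gt0.
    by rewrite -(natrB _ (ltnW lt)) normr_nat ler1n subn_gt0.
  rewrite (le_trans (ler_peMl (sqr_ge0 _) d1)) // lerDl.
  by apply: sumr_ge0 => j _; rewrite -expr2 sqr_ge0.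
have [f fP] := @choice _ _
  (fun (a : {ffun 'I_m -> 'I_n}) p => p \in s /\ dnorm dot (g a - p) <= r)
  (fun a => let: ex_intro2 p ps gp := sc _ (gV a) (g1 a) in
            ex_intro _ p (conj ps gp)).
have fI : injective f.
  move=> a b fab; apply/eqP; apply: contraT => /gB; rewrite leNgt => /negP[].
  apply: (le_lt_trans (dnorm_dist_trans dot (f a) _ _)).
  have h1 := (fP a).2; have h2 := (fP b).2; rewrite -fab dnormr_distC in h2.
  apply: (le_lt_trans (lerD h1 h2)).
  have : 2 * r < (m * n)%:R^-1 by rewrite -[ltRHS]div1r ltr_pdivlMr.
  by lra.
rewrite -[n in (n ^ _)%N]card_ord -[m in (_ ^ m)%N]card_ord -card_ffun.
rewrite cardE -(size_map f); apply: uniq_leq_size.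
  by rewrite map_inj_uniq // enum_uniq.
by move=> _ /mapP[a _ ->]; exact: (fP a).1.
Qed.

(* [mem_orthov1] with [dot] at its own structure, for rewriting. *)
Lemma mem_orthov_dot (u v : X) : (u \in orthov dot <[v]>) = (dot u v == 0).
Proof. exact: mem_orthov1. Qed.

Lemma ball_packing (V : {vspace X}) (m t : nat) (e : 'I_m -> X) (delta : R) :
  (0 < m)%N -> (forall i, e i \in V) ->
  (forall i j, dot (e i) (e j) = (i == j)%:R) ->
  0 < delta -> delta ^+ m * 2 ^+ t.+1 = 1 ->
  exists s, [/\ size s = (2 ^ t).+1,
    forall x, x \in s -> x \in V /\ dnorm dot x <= 1 & separated delta s].
Proof.
move=> m0 eV eE d0 dm.
have [//|[s [sk sB sc]]] := pack_or_cover
  (fun x => x \in V /\ dnorm dot x <= 1) delta (2 ^ t).+1 (ltW d0).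
(* Here delta^(mj) = 2^-N. A grid of side 2^(N-2m) is fine enough since 2m < 4^m, and outnumbers the
   cover of size at most 2^(tmj) once N - 2m > tj, that is j > 2m. *)
exfalso; pose j := (m.*2).+1; pose N := (t.+1 * j)%N.
have sV : {subset s <= V} by move=> x /sB[].
have sc' x : x \in V -> dnorm dot x <= 1 ->
    exists2 p, p \in s & dnorm dot (x - p) <= delta by move=> xV x1; exact: sc.
have [s' [ss' _ s'c]] := ball_cover_exp V delta s (m * j) d0 sV sc'.
have NE : (m.*2 <= N)%N by rewrite /N /j; nia.
have dN : delta ^+ (m * j) * 2 ^+ N = 1.
  by rewrite /N !exprM -exprMn dm expr1n.
have rmn : 2 * delta ^+ (m * j) * (m * 2 ^ (N - m.*2))%:R < 1.
  have lt2m : (2 * (m * 2 ^ (N - m.*2)) < 2 ^ N)%N.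
    rewrite -[in ltnRHS](subnKC NE) expnD mulnA ltn_pmul2r ?expn_gt0 // mul2n.
    exact: ltn_expl.
  rewrite mulrAC -natrM -[ltRHS]dN mulrC ltr_pM2l ?exprn_gt0 //.
  by rewrite -natrX ltr_nat.
have n0 : (0 < 2 ^ (N - m.*2))%N by rewrite expn_gt0.
have := grid_le_cover V m _ e _ s' m0 n0 eV eE s'c rmn.
rewrite ss' leqNgt => /negP[].
apply: (@leq_ltn_trans ((2 ^ t) ^ (m * j))%N).
  by rewrite leq_exp2r ?muln_gt0 ?m0.
rewrite -!expnM ltn_exp2l // /N /j; nia.
Qed.

(* Lifting the flat ball to the upper hemisphere does not decrease distances. *)
Lemma sphere_packing (m t : nat) (delta : R) :
  (0 < m)%N -> \dim {:X} = m.+1 -> 0 < delta -> delta ^+ m * 2 ^+ t.+1 = 1 ->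
  exists s, [/\ size s = (2 ^ t).+1, forall x, x \in s -> usphere dot x
    & separated delta s].
Proof.
move=> m0 dX d0 dm.
have [e eE] := @orthonormal_family m.+1 ltac:(by rewrite dX).
pose V := orthov dot <[e m]>%VS.
have [||s [sk sB [us ps]]] :=
    ball_packing V m t (fun i : 'I_m => e i) delta m0 _ _ d0 dm.
- by move=> i; rewrite mem_orthov_dot eE ?(ltn_eqF (ltn_ord i)) // ltnS ltnW.
- by move=> i k; rewrite eE // ltnS ltnW.
pose lift x := x + Num.sqrt (1 - dot x x) *: e m.
have lift_dist x y : x \in V -> y \in V ->
    dnorm dot (x - y) <= dnorm dot (lift x - lift y).
  move=> xV yV; rewrite -ler_sqr ?nnegrE ?dnormr_ge0 // !sqr_dnorm /lift.
  set a := Num.sqrt _; set b := Num.sqrt _.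
  have -> : x + a *: e m - (y + b *: e m) = x - y + (a - b) *: e m.
    by rewrite scalerBl opprD addrACA.
  (* By Pythagoras the lift adds (a - b)^2 to the squared distance. *)
  have /eqP xye : dot (x - y) (e m) == 0 by rewrite -mem_orthov_dot memvB.
  by rewrite [leRHS]dot_sqrD dotZr xye dotZl dotZr eE // eqxx !mulr0
    addr0 mulr1 -expr2 lerDl sqr_ge0.
exists (map lift s); split; first by rewrite size_map.
  move=> _ /mapP[x /sB[xV x1] ->]; rewrite /usphere /= /dnorm dot_sqrD dotZr.
  move: (xV); rewrite mem_orthov_dot => /eqP->.
  rewrite dotZl dotZr eE // eqxx mulr1 -expr2 sqr_sqrtr.
    by rewrite !mulr0 addr0 addrC subrK sqrtr1.
  by rewrite subr_ge0 -sqr_dnorm expr_le1 ?dnormr_ge0.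
have lift_sep x y : x \in s -> y \in s -> x != y ->
    delta < dnorm dot (lift x - lift y).
  move=> xs ys xy; apply: lt_le_trans (ps _ _ xs ys xy) _.
  by apply: lift_dist; [case: (sB x)|case: (sB y)].
split.
  rewrite map_inj_in_uniq // => x y xs ys xy; apply/eqP; apply: contraT.
  move=> /(lift_sep _ _ xs ys).
  by rewrite xy subrr dnormr0 ltNge ltW.
move=> _ _ /mapP[x xs ->] /mapP[y ys ->] xy; apply: lift_sep => //.
by apply: contraNneq xy => ->.
Qed.

End Packing.

(** Makes the strict separation of finitely many vectors uniform, leaving room for perturbation. *)
Lemma seq_pos_lower_bound (R : realDomainType) (T : eqType) (s : seq T)
    (f : T -> R) :
  {in s, forall x, 0 < f x} -> exists2 mu, 0 < mu & {in s, forall x, mu <= f x}.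
Proof.
elim: s => [|a s IH] fs; first by exists 1.
have [x xs|mu mu0 muP] := IH; first by apply: fs; rewrite inE xs orbT.
exists (Num.min (f a) mu); first by rewrite lt_min mu0 fs ?mem_head.
by move=> x; rewrite inE ge_min => /predU1P[->|/muP->]; rewrite ?lexx ?orbT.
Qed.

(** * Perturbation of unit vectors and the halving adversary *)

Section Adversary.
Context {R : realType} {X : vectType R} {dot : {dot X for idfun}}.

(** By Cauchy-Schwarz, moving c by less than |<c,v>|/|v| changes <c,v> by less than its absolute
    value. *)
Lemma sign_near (c v : X) : dot c v != 0 ->
  exists2 eps, 0 < eps & forall c', dnorm dot (c' - c) < eps ->
    sign (dot c' v) = sign (dot c v).
Proof.
move=> cv; have v0 : 0 < dnorm dot v.
  rewrite lt_def dnormr_ge0 dnormr_eq0 andbT.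
  by apply: contraNneq cv => ->; rewrite linear0r.
exists (`|dot c v| / dnorm dot v); first by rewrite divr_gt0 ?normr_gt0.
move=> c'; rewrite ltr_pdivlMr // => /(le_lt_trans (dot_le_dnorm dot _ _)).
rewrite linearBl /= => lt; apply/val_inj => /=.
move: cv lt; rewrite ltr_norml.
by case: (sgzP (dot c v)) => [->|?|?]; case: (sgzP (dot c' v)) => [->|?|?];
  rewrite ?eqxx // => _ /andP[? ?]; exfalso; lra.
Qed.

(** When c is orthogonal to v, it is rotated slightly towards v. *)
Lemma perturb (c v : X) (eps : R) : usphere dot c -> v != 0 -> 0 < eps ->
  exists c', [/\ usphere dot c', dnorm dot (c' - c) < eps & dot c' v != 0].
Proof.
move=> c1 v0 e0; have [cv|cv] := eqVneq (dot c v) 0; last first.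
  by exists c; split=> //; rewrite subrr dnormr0.
have vn0 : 0 < dnorm dot v by rewrite lt_def dnormr_ge0 dnormr_eq0 v0.
pose w := (dnorm dot v)^-1 *: v.
have cw : dot c w = 0 by rewrite dotZr cv mulr0.
have w1 : dot w w = 1.
  rewrite -sqr_dnorm dnormrZ ger0_norm ?invr_ge0 ?dnormr_ge0 // mulVf ?expr1n //.
  by rewrite gt_eqF.
have wv : dot w v != 0.
  by rewrite dotZl mulf_neq0 ?invr_eq0 ?gt_eqF ?neq0_dnorm_gt0.
clearbody w.
(* As a^2 + b^2 = 1, the squared displacement is 2 - 2a <= 2 b^2 <= eps^2/2. *)
pose b := Num.min 1 (eps / 2); pose a := Num.sqrt (1 - b ^+ 2).
have b0 : 0 < b by rewrite lt_min ltr01 divr_gt0.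
have b1 : b <= 1 by rewrite ge_min lexx.
have be : b <= eps / 2 by rewrite ge_min lexx orbT.
have a0 : 0 <= a by exact: sqrtr_ge0.
have aE : a ^+ 2 = 1 - b ^+ 2 by rewrite sqr_sqrtr // subr_ge0 expr_le1 // ltW.
exists (a *: c + b *: w); split.
- rewrite /usphere /= /dnorm dot_sqrD !(dotZl, dotZr) cw w1 dot_unit //.
  by rewrite !mulr1 -!expr2 aE !mulr0 addr0 subrK sqrtr1.
- rewrite -ltr_sqr ?nnegrE ?dnormr_ge0 ?(ltW e0) // sqr_dnorm.
  have -> : a *: c + b *: w - c = (a - 1) *: c + b *: w.
    by rewrite scalerBl scale1r addrAC.
  rewrite dot_sqrD !(dotZl, dotZr) cw w1 dot_unit //.
  nra.
- by rewrite linearDl /= !dotZl cv mulr0 add0r mulf_neq0 ?(gt_eqF b0).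
Qed.

Context {dO : measure_display} {Omega : measurableType dO}.
Context {dY : measure_display} {Y : measurableType dY} {t : nat}.
Context (alg : algorithm dot Omega Y t) (xi : Omega).

(* Asking for the history on a whole neighbourhood of the witness lets later
   rounds move the witness off the query hyperplane. *)
Definition robust (eta : R) (k : nat) (kt : (k <= t)%N)
    (h : k.-tuple (round dot)) (c : X) :=
  exists c', [/\ usphere dot c', dnorm dot (c' - c) < eta
    & exists2 eps, 0 < eps & forall c'', dnorm dot (c'' - c') < eps ->
        history alg xi c'' kt = h].

(** Comparing a point with itself yields 0 for every c, so the old witness is kept. *)
Lemma robust_tie (eta : R) (k : nat) (kt : (k < t)%N)
    (h : k.-tuple (round dot)) (c : X) :
  let pq := query alg (i := Ordinal kt) (h, xi) in
  pq.1 = pq.2 :> X -> robust eta k (ltnW kt) h c ->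
  robust eta k.+1 kt (rcons_tuple h (pq.1, pq.2, sign (0 : R))) c.
Proof.
move=> pq pqE [c' [c'1 c'c [eps e0 c'h]]]; exists c'; split=> //.
exists eps => // c'' /c'h /= ->; rewrite -/pq /oracle /utility pqE subrr.
by [].
Qed.

(** Once the witness is off the query hyperplane, the answer is nonzero and locally constant. *)
Lemma robust_split (eta : R) (k : nat) (kt : (k < t)%N)
    (h : k.-tuple (round dot)) (c : X) :
  let pq := query alg (i := Ordinal kt) (h, xi) in
  pq.1 != pq.2 :> X -> robust eta k (ltnW kt) h c ->
  robust eta k.+1 kt (rcons_tuple h (pq.1, pq.2, sign (1 : R))) c \/
  robust eta k.+1 kt (rcons_tuple h (pq.1, pq.2, sign (-1 : R))) c.
Proof.
move=> pq pqE [c' [c'1 c'c [eps e0 c'h]]].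
pose v : X := (pq.2 : X) - (pq.1 : X).
have v0 : v != 0 by rewrite subr_eq0 eq_sym.
(* The first radius preserves the history so far, the second keeps the new witness within [eta] of
   c. *)
have m0 : 0 < Num.min eps (eta - dnorm dot (c' - c)).
  by rewrite lt_min e0 subr_gt0.
have [d [d1 dc' dv]] := perturb c' v _ c'1 v0 m0.
move: dc'; rewrite lt_min => /andP[dc' dc].
have [mu mu0 near] := sign_near d v dv.
have key (z : R) : sign (dot d v) = sign z ->
    robust eta k.+1 kt (rcons_tuple h (pq.1, pq.2, sign z)) c.
  move=> dz; exists d; split=> //.
    by apply: le_lt_trans (dnorm_dist_trans dot c' _ _) _; rewrite -ltrBrDr.
  exists (Num.min mu (eps - dnorm dot (d - c'))).
    by rewrite lt_min mu0 subr_gt0.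
  move=> d'; rewrite lt_min => /andP[d'd d'c'] /=.
  have -> : history alg xi d' (ltnW kt) = h.
    apply: c'h; apply: le_lt_trans (dnorm_dist_trans dot d _ _) _.
    by rewrite -ltrBrDr.
  by rewrite -/pq /oracle /utility -linearBr -/v near // dz.
move: (dv); rewrite neq_lt => /orP[dv0|dv0]; [right|left]; apply: key;
  apply/val_inj => /=.
- by rewrite ltr0_sgz // sgzN sgz1.
- by rewrite gtr0_sgz // sgz1.
Qed.

(** Pigeonhole: of 2M + 1 survivors, at least M + 1 admit a common next answer. *)
Lemma adversary (eta : R) (s : seq X) : 0 < eta -> uniq s ->
  size s = (2 ^ t).+1 -> (forall c, c \in s -> usphere dot c) ->
  forall k (kt : (k <= t)%N), exists h s', [/\ size s' = (2 ^ (t - k)).+1,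
    uniq s', {subset s' <= s} & forall c, c \in s' -> robust eta k kt h c].
Proof.
move=> eta0 us ss s1; elim=> [|k IH] kt.
  exists [tuple], s; split=> //; first by rewrite subn0.
  move=> c cs; exists c; split; first exact: s1.
    by rewrite subrr dnormr0.
  by exists 1.
have [h [s' [ss' us' s's s'h]]] := IH (ltnW kt).
pose pq := query alg (i := Ordinal kt) (h, xi).
have sz : (2 ^ (t - k) = 2 * 2 ^ (t - k.+1))%N by rewrite -expnS subnSK.
have select (a : pred X) h' : ((2 ^ (t - k.+1)).+1 <= count a s')%N ->
    (forall c, c \in s' -> a c -> robust eta k.+1 kt h' c) ->
  exists h s', [/\ size s' = (2 ^ (t - k.+1)).+1,
    uniq s', {subset s' <= s} & forall c, c \in s' -> robust eta k.+1 kt h c].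
  move=> lea ah; exists h', (take (2 ^ (t - k.+1)).+1 [seq c <- s' | a c]).
  have sub c : c \in take (2 ^ (t - k.+1)).+1 [seq c <- s' | a c] -> c \in s' /\ a c.
    by move=> /mem_take; rewrite mem_filter => /andP[].
  split.
  - by rewrite size_take_min size_filter; exact/minn_idPl.
  - by rewrite take_uniq // filter_uniq.
  - by move=> c /sub[/s's].
  - by move=> c /sub[cs' ac]; exact: ah.
have [pqE|pqE] := eqVneq (pq.1 : X) (pq.2 : X).
  apply: (select predT (rcons_tuple h (pq.1, pq.2, sign (0 : R)))).
    by rewrite count_predT ss' sz; lia.
  by move=> c cs' _; apply: robust_tie => //; exact: s'h.
pose hz (z : R) := rcons_tuple h (pq.1, pq.2, sign z).
pose a c := `[< robust eta k.+1 kt (hz 1) c >].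
have := count_predC a s'; rewrite ss' sz => ca.
have [lea|lta] := leqP (2 ^ (t - k.+1)).+1 (count a s').
  by apply: (select a (hz 1)) => // c _ /asboolP.
(* At most M = 2^(t-k-1) survivors admit the answer 1; the others, at least M + 1, must admit -1. *)
apply: (select (predC a) (hz (-1))); first by lia.
move=> c cs' /asboolPn nc.
by case: (robust_split eta k kt h c pqE (s'h c cs')).
Qed.

End Adversary.

(** * Choice of scale and extraction of the indistinguishable pair *)

Theorem theorem3p14 (R : realType) (X : vectType R) (dot : {dot X for idfun})
    (d : nat) (dimX : \dim {:X} = d) (d_ge2 : (2 <= d)%N)
    (t : nat) (t_ge1 : (1 <= t)%N)
    (dO : measure_display) (Omega : measurableType dO)
    (dY : measure_display) (Y : measurableType dY)
    (alg : algorithm dot Omega Y t) (xi : Omega) :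
  exists c chat : X,
    [/\ usphere dot c, usphere dot chat,
        angle dot c chat > 2 `^ (- (t%:R + 1) / (d%:R - 1))
      & transcript alg xi c = transcript alg xi chat].
Proof.
case: d d_ge2 dimX => [//|m] m_ge1 dimX.
set delta := 2 `^ _.
have d0 : 0 < delta by exact: powR_gt0.
have dm : delta ^+ m * 2 ^+ t.+1 = 1.
  have m0 : m%:R != 0 :> R by rewrite pnatr_eq0 -lt0n.
  rewrite -powR_mulrn ?(ltW d0) // /delta -powRrM -[m.+1%:R]natr1 addrK divfK //.
  by rewrite natr1 powR_invn // mulVf // expf_neq0.
have [s [ss s1 [us sep]]] := sphere_packing dot m t delta m_ge1 dimX d0 dm.
(* All distinct pairs are at distance at least delta + mu for some mu > 0. Moving both endpoints by
   less than mu/2 leaves their distance above delta. *)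
pose pairs := [seq p <- [seq (x, y) | x <- s, y <- s] | p.1 != p.2].
have [p|mu mu0 muP] := @seq_pos_lower_bound _ _ pairs
    (fun p => dnorm dot (p.1 - p.2) - delta).
  rewrite mem_filter subr_gt0 => /andP[pne /allpairsP[[x y] /= [xs ys pE]]].
  by move: pne; rewrite pE; exact: sep.
have eta0 : 0 < mu / 2 by rewrite divr_gt0.
have [h [s' [ss' us' s's s'h]]] :=
  adversary alg xi (mu / 2) s eta0 us ss s1 t (leqnn t).
(* After t rounds exactly 2^0 + 1 = 2 vectors remain. *)
move: ss' us' s's s'h; rewrite subnn expn0.
case: s' => [|x [|y []]] //= _; rewrite inE andbT => xy s's s'h.
have xs : x \in s by rewrite s's ?mem_head.
have ys : y \in s by rewrite s's // !inE eqxx orbT.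
have [c [c1 cx [e1 e10 ch]]] := s'h x (mem_head _ _).
have [c' [c'1 c'y [e2 e20 c'h]]] : robust alg xi (mu / 2) t (leqnn t) h y.
  by apply: s'h; rewrite !inE eqxx orbT.
exists c, c'; split=> //; last first.
  by rewrite /transcript ch ?c'h // subrr dnormr0.
apply: lt_le_trans (dnorm_dist_le_angle dot _ _ c1 c'1).
have /muP /= : (x, y) \in pairs.
  by rewrite mem_filter xy; apply/allpairsP; exists (x, y).
have := dnorm_dist_trans dot c x y; have := dnorm_dist_trans dot c' c y.
rewrite (dnormr_distC dot x c); lra.
Qed.
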